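(* Let $r\ge 1$ be an integer. If $\lambda\in(0,1)$ is close enough to $1$ (depending on $r$), then the iterated functions system generated by the two maps $\widehat f_{+1},\widehat f_{-1}$ acting on the $r$-jet space $J^r_0(\mathbb I,\mathbb R)\cong\mathbb R^{r+1}$, $$\widehat f_{\pm1}(x_0,x_1,\dots,x_r)=(\lambda x_0\pm 1,\ \lambda x_1+x_0,\ \lambda x_2+2x_1,\ \dots,\ \lambda x_r+r\,x_{r-1}),$$ satisfies the (open) covering property: there exists a non-empty open set $U$ of $J^r_0(\mathbb I,\mathbb R)$ such that $$\operatorname{Closure}(U)\subset \widehat f_{+1}(U)\cup\widehat f_{-1}(U).$$
   Context: Here $\mathbb I=[-1,1]$, and $J^r_0(\mathbb I,\mathbb R)$ is the space of $r$-jets $(x_a,\partial_a x_a,\dots,\partial_a^r x_a)_{|a=0}$ of $C^r$ functions $a\mapsto x_a$ from $\mathbb I$ to $\mathbb R$, identified with $\mathbb R^{r+1}$ by writing $x_i=(\partial_a^i x_a)_{|a=0}$. The maps $\widehat f_{\pm1}$ are the maps induced on $r$-jets at $a=0$, namely $(\partial_a^i x_a)_{0\le i\le r\,|a=0}\mapsto(\partial_a^i(f_{\pm1,a}(x_a)))_{0\le i\le r\,|a=0}$, by the parametrized affine maps $f_{\pm1,a}(x)=\lambda_a x\pm1$ of $\mathbb R$, where $\lambda_a=\lambda+a$ for $a$ in a neighborhood of $0$. In general, an iterated functions system $(f_b)_{b\in B}$ ($B$ finite) on $\mathbb R^n$ is said to satisfy the covering property if there exists a non-empty open set $U$ of $\mathbb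 R^n$ such that $\operatorname{Closure}(U)\subset\bigcup_{b\in B}f_b(U)$. *)

(* Defs.v *)
From mathcomp Require Import all_boot all_order all_algebra.
From mathcomp Require Import all_classical all_reals all_analysis.
From mathcomp Require Import ring.

Set Implicit Arguments.
Unset Strict Implicit.
Unset Printing Implicit Defensive.

Import Order.TTheory GRing.Theory Num.Theory.
Import numFieldNormedType.Exports.

Local Open Scope classical_set_scope.
Local Open Scope ring_scope.

(* Only the germ of [x] at 0 matters for its jet at 0, and germs at 0 of C^r
   functions on [-1, 1] are the same as germs of C^r functions on neighborhoods
   of 0; hence functions are total on R and smooth near 0. *)
Definition Cr_near0 (R : realType) (r : nat) (x : R -> R) : Prop :=
  \forall a \near (0 : R),
    (forall i, (i < r)%N -> derivable (derive1n i x) a 1) /\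
    {for a, continuous (derive1n r x)}.

(* The coordinates are the derivatives themselves, not divided by [i`!]. *)
Definition jet (R : realType) (r : nat) (x : R -> R) : 'rV[R]_r.+1 :=
  \row_(i < r.+1) derive1n i x 0.

Definition pm1 (R : realType) (b : bool) : R := if b then 1 else -1.

Definition faff (R : realType) (lambda : R) (b : bool) (a x : R) : R :=
  (lambda + a) * x + pm1 R b.

(* In coordinates:
   (lambda x_0 +- 1, lambda x_1 + x_0, lambda x_2 + 2 x_1, ...,
    lambda x_r + r x_(r-1)). *)
Definition fhat (R : realType) (r : nat) (lambda : R) (b : bool)
    (x : 'rV[R]_r.+1) : 'rV[R]_r.+1 :=
  \row_(i < r.+1) (lambda * x 0 i +
    if val i is j.+1 then j.+1%:R * x 0 (inord j) else pm1 R b).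

(* [U] has to be bounded: for a nonempty system of affine bijections, the whole
   space would otherwise always be a witness and the property would be void. *)
Definition covering_property (R : realType) (n : nat) (B : finType)
    (f : B -> 'rV[R]_n.+1 -> 'rV[R]_n.+1) : Prop :=
  exists U : set 'rV[R]_n.+1,
    [/\ U !=set0, open U, bounded_set U &
        closure U `<=` \bigcup_(b in [set: B]) (f b @` U)].

Lemma derive1n_faff (R : realType) (r : nat) (lambda : R) (b : bool)
    (x : R -> R) (i : nat) : Cr_near0 r x -> (i <= r)%N ->
  \forall a \near (0 : R), derive1n i (fun a => faff lambda b a (x a)) a =
    (lambda + a) * derive1n i x a +
    if i is j.+1 then j.+1%:R * derive1n j x a else pm1 R b.
Proof.
move=> xr; elim: i => [|i IH] ir; first exact: (@filterE _ (nbhs (0 : R))).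
have := near_join (IH (ltnW ir)).
apply: filterS2 xr => a [dx _] IHa.
have d1 : is_derive a (1 : R) (fun a => lambda + a) 1.
  apply: is_derive_eq (is_deriveD (is_derive_cst _ _ _) (is_derive_id _ _)) _.
  by rewrite add0r.
have dn k : (k < r)%N -> is_derive a (1 : R) (derive1n k x) (derive1n k.+1 x a).
  by move=> kr; rewrite derive1nS derive1E; apply/derivableP/dx.
have d2 := dn i ir.
rewrite derive1nS derive1E (near_eq_derive _ IHa).
have dM : is_derive a (1 : R) (fun a => (lambda + a) * derive1n i x a)
    ((lambda + a) * derive1n i.+1 x a + derive1n i x a).
  apply: is_derive_eq (is_deriveM d1 d2) _.
  by rewrite /GRing.scale/= mulr1.
case: i ir {IH IHa} d2 dM => [|i] ir d2 dM.
  rewrite mul1r; apply: derive_val.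
  by apply: is_derive_eq (is_deriveD dM (is_derive_cst _ _ _)) _; rewrite addr0.
have d3 := dn i (ltnW ir).
apply: derive_val.
apply: is_derive_eq (is_deriveD dM (is_deriveZ i.+1%:R d3)) _.
by rewrite /GRing.scale/= -[in RHS]natr1; ring.
Qed.

(* Together with [jet_surj], this identifies [fhat lambda b] as the only map
   that [faff lambda b] induces on r-jets at 0. *)
Lemma fhat_jet (R : realType) (r : nat) (lambda : R) (b : bool) (x : R -> R) :
  Cr_near0 r x ->
  fhat lambda b (jet r x) = jet r (fun a => faff lambda b a (x a)).
Proof.
move=> xr; apply/rowP => -[i ir]; rewrite !mxE/=.
rewrite (nbhs_singleton (derive1n_faff lambda b xr ir)) addr0.
by case: i ir => // i ir; rewrite mxE inordK// ltnW.
Qed.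

Lemma jet_surj (R : realType) (r : nat) (y : 'rV[R]_r.+1) :
  exists2 x : R -> R, Cr_near0 r x & jet r x = y.
Proof.
pose p : {poly R} := \poly_(i < r.+1) (y 0 (inord i) / i`!%:R).
have dp n : derive1n n (horner p) = horner p^`(n).
  by elim: n => [//|n IH]; rewrite derive1nS IH -derivE.
exists (horner p).
  apply: (@filterE _ (nbhs (0 : R))) => a; split => [i _|]; rewrite dp.
    exact: derivable_horner.
  exact: continuous_horner.
apply/rowP => i; rewrite mxE dp horner_coef0 coef_derivn addn0 ffactnn.
rewrite coef_poly ltn_ord inord_val -[LHS]mulr_natr divfK//.
Qed.

(* Main.v *)
(* Put eps = 1 - lambda. In the scaled reversed coordinates
   v_i = x_(r-i) eps^(r-i+1) / (r-i)!, the equation fhat b y = x reads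
   v_i(x) = lambda v_i(y) + eps v_(i+1)(y) for i <= r, with v_(r+1)(y) = b = +-1:
   inverting fhat is an implicit Euler step of size eps for a chain of
   integrators controlled by b. Let z, w be the values of the functionals
   (shift - 3)^j v at x and y. Then z_j = (1 + 2 eps) w_j + eps w_(j+1) for
   j <= r, and w_(r+1) = b - E, where E is a linear form in w_0, ..., w_r. On a
   small box |z_j| <= d the error E is at most 1/4, so taking for b the sign of
   z_r gives |w_r| < d, and then |w_j| < d by descending induction on j. Hence
   the open box |z_j| < d covers its closure. *)

Require Import Defs.
From mathcomp Require Import all_boot all_order all_algebra.
From mathcomp Require Import all_classical all_reals all_analysis.
From mathcomp Require Import ring lra.

Set Implicit Arguments.
Unset Strict Implicit.
Unset Printing Implicit Defensive.

Import Order.TTheory GRing.Theory Num.Theory.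
Import numFieldNormedType.Exports.

Local Open Scope classical_set_scope.
Local Open Scope ring_scope.

(* The value at [('X - a) ^+ j] of the linear functional ['X^i |-> v i]. *)
Fixpoint bcoord (R : pzRingType) (a : R) (v : nat -> R) (j : nat) : R :=
  if j is k.+1 then bcoord a (fun i => v i.+1 - a * v i) k else v 0%N.

Lemma eq_bcoord (R : pzRingType) (a : R) (u v : nat -> R) (j : nat) :
  (forall i, (i <= j)%N -> u i = v i) -> bcoord a u j = bcoord a v j.
Proof.
elim: j u v => [|j IH] u v uv /=; first exact: uv.
by apply: IH => i ij; rewrite !uv ?ltnS// leqW.
Qed.

Lemma bcoord_lin (R : comPzRingType) (a k l : R) (u v : nat -> R) (j : nat) :
  bcoord a (fun i => k * u i + l * v i) j = k * bcoord a u j + l * bcoord a v j.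
Proof.
elim: j u v => [//|j IH] u v /=; rewrite -IH.
by apply: eq_bcoord => i _; ring.
Qed.

(** Shifting the sequence multiplies the argument of the functional by ['X] = (['X] - a) + a. *)
Lemma bcoord_shift (R : comPzRingType) (a : R) (v : nat -> R) (j : nat) :
  bcoord a (fun i => v i.+1) j = bcoord a v j.+1 + a * bcoord a v j.
Proof.
rewrite /= -[X in X + _]mul1r -bcoord_lin.
by apply: eq_bcoord => i _; ring.
Qed.

(** Expand ['X^j] in powers of ['X - a]: the coefficients are nonnegative with sum (1 + a)^j, and
    the leading one, equal to 1, is moved to the left. The induction passes to the shifted sequence,
    whose values are at most (1 + a) M. *)
Lemma bcoord_bound (R : realDomainType) (a M : R) (v : nat -> R) (j : nat) :
  0 <= a -> (forall i, (i < j)%N -> `|bcoord a v i| <= M) ->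
  `|v j - bcoord a v j| <= ((1 + a) ^+ j - 1) * M.
Proof.
move=> a0; elim: j v M => [|j IH] v M vM.
  by rewrite subrr normr0 expr0 subrr mul0r.
have IHs : `|v j.+1 - bcoord a (fun i => v i.+1) j|
    <= ((1 + a) ^+ j - 1) * ((1 + a) * M).
  apply: (IH (fun i => v i.+1)) => i ij; rewrite bcoord_shift.
  rewrite (le_trans (ler_normD _ _))// normrM (ger0_norm a0) mulrDl mul1r.
  by apply: lerD; [exact: vM | apply: ler_wpM2l => //; apply/vM/leqW].
have aM : a * `|bcoord a v j| <= a * M by apply: ler_wpM2l => //; exact: vM.
rewrite [X in v _ - X](_ : _ = bcoord a (fun i => v i.+1) j - a * bcoord a v j);
  last by rewrite bcoord_shift addrK.
rewrite opprB addrC -addrA (le_trans (ler_normD _ _))// normrM (ger0_norm a0).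
rewrite [_ + v _]addrC exprS.
apply: le_trans (lerD aM IHs) _.
by rewrite le_eqVlt; apply/orP; left; apply/eqP; ring.
Qed.

Lemma bcoord_continuous (R : realType) (T : topologicalType) (a : R)
    (v : T -> nat -> R) (j : nat) :
  (forall i, continuous (v^~ i)) -> continuous (fun t => bcoord a (v t) j).
Proof.
elim: j v => [|j IH] v vc /=; first exact: vc.
apply: (IH (fun t i => v t i.+1 - a * v t i)) => i t.
by apply: cvgB; [exact: vc | apply: cvgM; [exact: cvg_cst | exact: vc]].
Qed.

Lemma box_step (R : realFieldType) (r : nat) (eps K b : R) (z w : nat -> R) :
  1 <= K -> 0 < eps -> 16 * K * eps < 1 ->
  b = (if 0 <= z r then 1 else -1) ->
  (forall j, (j <= r)%N -> `|z j| <= (8 * K)^-1) ->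
  (forall j, (j <= r)%N -> z j = (1 + 2 * eps) * w j + eps * w j.+1) ->
  (forall M, (forall j, (j <= r)%N -> `|w j| <= M) -> `|b - w r.+1| <= K * M) ->
  forall j, (j <= r)%N -> `|w j| < (8 * K)^-1.
Proof.
move=> K1 e0 Ke bz zd zw wK; set d := (8 * K)^-1 in zd *.
have K0 : 0 < K by lra.
have dK : K * d = 8^-1 by rewrite /d; field; lra.
have d0 : 0 < d by rewrite /d invr_gt0; lra.
have ed : eps < d / 2.
  by rewrite -(ltr_pM2l K0) mulrA dK; lra.
have b1 : `|b| = 1 by rewrite bz; case: ifP; rewrite ?normrN normr1.
(* A crude bound first: where |w| attains its maximum M, the relation with z gives (1 + 2 eps) M <=
   d + eps (1 + K M), and K eps < 1/16, eps < d / 2 force M <= 2 d. *)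
have w2 j : (j <= r)%N -> `|w j| <= 2 * d.
  pose m := [arg max_(i > (ord0 : 'I_r.+1)) `|w i|]%O.
  have wm k : (k <= r)%N -> `|w k| <= `|w m|.
    move=> kr; rewrite /m; case: arg_maxP => //= i _ iP.
    exact: (iP (Ordinal (kr : (k < r.+1)%N))).
  move=> jr; apply: le_trans (wm _ jr) _; set M := `|w m| in wm *.
  have mr : (m <= r)%N by rewrite -ltnS.
  have wm1 : `|w m.+1| <= 1 + K * M.
    have M0 : 0 <= M by exact: normr_ge0.
    have := mr; rewrite leq_eqVlt => /predU1P[->|m_r].
      have := wK _ wm; have := ler_normB b (b - w r.+1).
      by rewrite opprB addrC subrK b1; lra.
    by have := wm _ m_r; nra.
  have M1 : (1 + 2 * eps) * M <= d + eps * (1 + K * M).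
    have -> : (1 + 2 * eps) * M = `|z m - eps * w m.+1|.
      by rewrite zw// addrK normrM ger0_norm//; lra.
    apply: le_trans (ler_normB _ _) _; apply: lerD; first exact: zd.
    by rewrite normrM (gtr0_norm e0) ler_pM2l.
  have M0 : 0 <= M by exact: normr_ge0.
  nra.
have wr1 : `|b - w r.+1| <= 4^-1.
  by apply: le_trans (wK _ w2) _; rewrite mulrCA dK; lra.
move=> j; move: {2}(r - j)%N (erefl (r - j)%N) => n; elim: n j => [|n IH] j jn jr.
  (* Now w_(r+1), within 1/4 of b, has the sign chosen from z_r, so subtracting eps w_(r+1) from z_r
     moves it inward; as eps < d / 2, it cannot overshoot to -d or d. *)
  have -> : j = r by apply/eqP; rewrite eqn_leq jr -subn_eq0 jn.
  have := zd _ (leqnn r); rewrite {1}zw// !ler_norml ltr_norml => /andP[].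
  move: wr1; rewrite ler_norml => /andP[].
  move: bz; case: ifP => zr bz; first by have := zr; rewrite zw// bz; nra.
  by move/negbT: zr; rewrite zw// bz -ltNge; nra.
(* Here (1 + 2 eps) |w_j| <= d + eps |w_(j+1)| < (1 + eps) d. *)
have j1r : (j < r)%N by rewrite -subn_gt0 jn.
have := IH j.+1; rewrite subnS jn => /(_ erefl j1r).
have := zd _ jr; rewrite {1}zw// !ler_norml !ltr_norml => /andP[? ?] /andP[? ?].
by apply/andP; split; nra.
Qed.

(* The entry past the last jet coordinate holds the control [c]. *)
Definition revjet (R : realType) (r : nat) (eps c : R) (x : 'rV[R]_r.+1)
    (i : nat) : R :=
  if (i <= r)%N then x 0 (inord (r - i)) * (eps ^+ (r - i).+1 / (r - i)`!%:R)
  else c.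

(** The weights absorb the factor k of k x_(k-1), since k eps^(k+1) / k! = eps (eps^k / (k-1)!); at
    i = r the translation part becomes eps times the control. *)
Lemma fhat_revjet (R : realType) (r : nat) (lambda eps c : R) (b : bool)
    (y : 'rV[R]_r.+1) (i : nat) : (i <= r)%N ->
  revjet eps c (fhat lambda b y) i =
    lambda * revjet eps (pm1 R b) y i + eps * revjet eps (pm1 R b) y i.+1.
Proof.
move=> ir; rewrite /revjet ir mxE /= inordK ?ltnS ?leq_subr//.
have [ri|] := ltnP i r; last first.
  by rewrite -subn_eq0 => /eqP ->; rewrite fact0 divr1; ring.
rewrite -(subnSK ri); set k := (r - i.+1)%N.
rewrite factS natrM [eps ^+ k.+2]exprS; field.
by rewrite pnatr_eq0 -lt0n fact_gt0 nat1r pnatr_eq0.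
Qed.

(** The system is lower bidiagonal with [lambda] on the diagonal: forward substitution solves it. *)
Lemma fhat_surj (R : realType) (r : nat) (lambda : R) (b : bool)
    (x : 'rV[R]_r.+1) : lambda != 0 -> exists y, fhat lambda b y = x.
Proof.
move=> l0.
pose fix g (k : nat) : R := (x 0 (inord k) -
  if k is j.+1 then j.+1%:R * g j else pm1 R b) / lambda.
exists (\row_i g i); apply/rowP => i; rewrite !mxE.
have -> : g i = (x 0 i - if val i is j.+1 then j.+1%:R * g j else pm1 R b) / lambda.
  by rewrite -[in RHS](inord_val i); case: (val i) (ltn_ord i) => [|k] ki /=;
    rewrite inordK.
rewrite mulrC divfK//; case: i => -[|k] ki /=; first by rewrite subrK.
by rewrite mxE inordK ?subrK// ltnW.
Qed.

Lemma revjet_continuous (R : realType) (r : nat) (eps c : R) (i : nat) :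
  continuous (fun x : 'rV[R]_r.+1 => revjet eps c x i).
Proof.
rewrite /revjet; case: (i <= r)%N => x; last exact: cst_continuous.
apply: (@cvgM _ _ (nbhs x)); [exact: coord_continuous | exact: cst_continuous].
Qed.

(** The control 0 is a placeholder: for j <= r only entries of index at most r are read, so every
    control gives the same set. *)
Definition jetbox (R : realType) (r : nat) (eps d : R) : set 'rV[R]_r.+1 :=
  [set x | forall j : 'I_r.+1, `|bcoord 3 (revjet eps 0 x) j| < d].

Lemma jetbox_continuous (R : realType) (r : nat) (eps : R) (j : nat) :
  continuous (fun x : 'rV[R]_r.+1 => `|bcoord 3 (revjet eps 0 x) j|).
Proof.
move=> x; have c : continuous (fun x : 'rV[R]_r.+1 => bcoord 3 (revjet eps 0 x) j).
  by apply: bcoord_continuous => i; exact: revjet_continuous.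
exact: (@cvg_norm _ R^o _ (nbhs x) _ _ _ (c x)).
Qed.

Lemma jetbox_open (R : realType) (r : nat) (eps d : R) : open (@jetbox R r eps d).
Proof.
rewrite openE => x xd; rewrite /interior /jetbox.
apply: (@filter_forall _ _ (fun (j : 'I_r.+1) (y : 'rV[R]_r.+1) =>
  `|bcoord 3 (revjet eps 0 y) j| < d) (nbhs x)) => j.
have /(_ [set t | t < d]) := @jetbox_continuous R r eps j x.
by apply; exact: lt_nbhsl (xd j).
Qed.

Lemma closure_jetbox (R : realType) (r : nat) (eps d : R) (x : 'rV[R]_r.+1)
    (j : nat) : closure (jetbox eps d) x -> (j <= r)%N ->
  `|bcoord 3 (revjet eps 0 x) j| <= d.
Proof.
move=> xU jr.
have cl : closed [set y : 'rV[R]_r.+1 | `|bcoord 3 (revjet eps 0 y) j| <= d].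
  apply: (closed_comp _ (@closed_le _ d)) => y _; exact: jetbox_continuous.
apply: cl; apply: closureS xU => y.
by move=> /(_ (Ordinal (jr : (j < r.+1)%N))) /ltW.
Qed.

Lemma jetbox_bounded (R : realType) (r : nat) (eps d : R) : 0 < eps ->
  bounded_set (@jetbox R r eps d).
Proof.
move=> e0; pose s (i : 'I_r.+1) : R := eps ^+ i.+1 / i`!%:R.
have s0 i : 0 < s i by rewrite divr_gt0 ?exprn_gt0// ltr0n fact_gt0.
(* The power bounds the factor from [bcoord_bound]; the extra 1 accounts for the term [bcoord]
   itself. *)
pose C : R := (1 + 3) ^+ r.+1 + 1.
have C0 : 0 <= C by rewrite addr_ge0// exprn_ge0// addr_ge0.
pose B := \sum_i C * `|d| / s i.
exists B; split; first exact: num_real.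
move=> M BM x xd; apply: le_trans (ltW BM).
have t0 i : 0 <= C * `|d| / s i.
  by apply: divr_ge0; [exact: mulr_ge0 | exact/ltW/s0].
rewrite /Num.norm/= mx_normrE; apply: bigmax_le => [|[i0 i] _ /=].
  exact: sumr_ge0.
rewrite ord1; apply: (@le_trans _ _ (C * `|d| / s i)); last first.
  by rewrite /B (bigD1 i)//= lerDl sumr_ge0.
rewrite ler_pdivlMr//.
have ir : (i <= r)%N by rewrite -ltnS.
have bd k : (k <= r)%N -> `|bcoord 3 (revjet eps 0 x) k| <= `|d|.
  move=> kr; apply: le_trans (ler_norm _).
  exact/ltW/(xd (Ordinal (kr : (k < r.+1)%N))).
have -> : `|x 0 i| * s i = `|revjet eps 0 x (r - i)|.
  by rewrite /revjet leq_subr subKn// inord_val normrM (gtr0_norm (s0 i)).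
have := @bcoord_bound R 3 `|d| (revjet eps 0 x) (r - i)%N (ler0n R 3).
move=> /(_ (fun k kr => bd k (leq_trans (ltnW kr) (leq_subr _ _)))) h.
rewrite -[revjet _ _ _ _](subrK (bcoord 3 (revjet eps 0 x) (r - i))).
apply: le_trans (ler_normD _ _) _; rewrite mulrDl mul1r; apply: lerD; last first.
  exact/bd/leq_subr.
apply: le_trans h _; apply: ler_wpM2r => //.
rewrite lerBlDr ler_wpDr// ler_weXn2l ?lerDl//.
by rewrite (leq_trans (leq_subr _ _)).
Qed.

Theorem theorem1 (R : realType) (r : nat) (hr : (1 <= r)%N) :
  exists2 lambda0 : R, lambda0 < 1 &
    forall lambda : R, 0 < lambda < 1 -> lambda0 < lambda ->
      covering_property (fun b : bool => @fhat R r lambda b).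
Proof.
(* This K bounds the form E: it comes from [bcoord_bound] with a = 3 at index r + 1, where the entry
   is the control. *)
pose K : R := (1 + 3) ^+ r.+1.
have K1 : 1 <= K by rewrite exprn_ege1// lerDl.
have K0 : 0 < K by exact: lt_le_trans ltr01 K1.
exists (1 - (16 * K)^-1) => [|lambda /andP[l0 l1] lK].
  by rewrite ltrBlDr ltrDl invr_gt0 mulr_gt0.
pose eps := 1 - lambda.
have e0 : 0 < eps by rewrite subr_gt0.
have Ke : 16 * K * eps < 1.
  by rewrite -ltr_pdivlMl ?mulr_gt0// mulr1 /eps; lra.
pose d := (8 * K)^-1.
have d0 : 0 < d by rewrite invr_gt0 mulr_gt0.
exists (jetbox eps d); split.
- exists 0 => j; rewrite (@eq_bcoord _ _ _ (fun i => 0 * 0 + 0 * 0)).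
    by rewrite (bcoord_lin 3 0 0 (fun=> 0) (fun=> 0)) !mul0r addr0 normr0.
  move=> i ij; have ir : (i <= r)%N by rewrite (leq_trans ij)// -ltnS.
  by rewrite /revjet ir mxE !mul0r addr0.
- exact: jetbox_open.
- exact: jetbox_bounded.
move=> x xU; pose z := bcoord 3 (revjet eps 0 x).
pose b := 0 <= z r.
have [y yx] := fhat_surj b x (lt0r_neq0 l0).
exists b => //; exists y => // j.
pose w := bcoord 3 (revjet eps (pm1 R b) y).
have -> : bcoord 3 (revjet eps 0 y) j = w j.
  apply: eq_bcoord => i ij; rewrite /revjet.
  by rewrite (leq_trans ij)// -ltnS.
apply: (@box_step R r eps K (pm1 R b) z) => //; last by rewrite -ltnS.
- by move=> k; exact: closure_jetbox.
- move=> k kr; rewrite /z -yx.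
  rewrite (@eq_bcoord _ _ _ (fun i => lambda * revjet eps (pm1 R b) y i +
    eps * revjet eps (pm1 R b) y i.+1)); last first.
    by move=> i ik; apply: fhat_revjet; exact: leq_trans ik kr.
  (* The shift by 3 turns [lambda] into lambda + 3 eps = 1 + 2 eps. *)
  by rewrite bcoord_lin bcoord_shift -/w /eps; ring.
- move=> M wM.
  have M0 : 0 <= M by apply: le_trans (wM 0%N _).
  have := @bcoord_bound R 3 M (revjet eps (pm1 R b) y) r.+1 (ler0n R 3) wM.
  rewrite -/w {1}/revjet ltnn => /le_trans; apply.
  by apply: ler_wpM2r => //; rewrite lerBlDr lerDl.
Qed.
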